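(* Let $R$ be a finite group and let $M$ be a subgroup of $R$ with $|R:M|=2$. There exists a non-identity automorphism $\varphi$ of $R$ with $g^\varphi\in \{g,g^{-1}\}$ for every $g\in R\setminus M$ if and only if one of the following holds: (1) $M$ is abelian and $R$ is not a generalised dihedral group on $M$; (2) $M$ contains an abelian subgroup $Z$ with $|M:Z|=2$ and there exists $a\in R\setminus M$ with $a^2\ne 1$, $a^2\in Z\cap Z(R)$ and $z^a=z^{-1}$ for every $z\in Z$; (3) $|M:Z(M)|=4$ and $\gamma_2(M)=\langle a^2\rangle$ for some $a\in R\setminus M$ such that $o(a)=4$, $z^a=z^{-1}$ for every $z\in Z(M)$, and $o(am)\ne 2$ for some $m\in M\setminus Z(M)$.
   Context: $Z(G)$ denotes the center of a group $G$, $\gamma_2(G)$ its commutator (derived) subgroup, and $o(g)$ the order of an element $g$. A group $D$ is a generalised dihedral group on $A$ if $A$ is an abelian subgroup of index $2$ in $D$ and there exists an involution $\iota\in D\setminus A$ with $a^\iota=a^{-1}$ for every $a\in A$. *)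

(* Defs.v *)
From mathcomp Require Import all_boot all_fingroup all_solvable.

Set Implicit Arguments.
Unset Strict Implicit.
Unset Printing Implicit Defensive.

Local Open Scope group_scope.

(* The involution is not required to act nontrivially on A, so an elementary
   abelian 2-group is generalised dihedral on each of its index 2 subgroups. *)
Definition generalised_dihedral_on (gT : finGroupType) (D A : {group gT}) :
    Prop :=
  [/\ A \subset D, abelian A, #|D : A| = 2
    & exists2 i, i \in D :\: A &
        #[i] = 2 /\ (forall a, a \in A -> a ^ i = a^-1)].

(* Main.v *)
Require Import Defs.
From mathcomp Require Import all_boot all_fingroup all_solvable.

(* Let [phi] be as in the theorem and suppose that [M] is not abelian. Then
   [phi] fixes some [b] outside [M], and with [K] the group of fixed points of
   [phi] in [M], [phi] maps each [m] in [M] outside [K] to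
   [b^-1 * m^-1 * b^-1]. Multiplicativity of [phi] on [m * k] with [k] in [K]
   reads [k ^ b = (k^-1) ^ (m^-1)], so that [K] is abelian and the elements of
   [M] outside [K] all act on [K] in the same way. If [K] has index 2 in [M],
   then [b * m] inverts [K], and (2) holds. Otherwise this common action is
   trivial and [K] is central in [M]; multiplicativity of [phi] on [m * n] then
   shows that [m] and [n] have commutator [b ^+ 2] as soon as [m], [n] and
   [m * n] are outside [K], which forces [K] to be the centre of [M], of index
   4, and (3) holds with [a = b].
   Conversely, in each of the three cases [phi] is obtained by extending an
   automorphism of [M] by a suitable image of [a]. *)

Set Implicit Arguments.
Unset Strict Implicit.
Unset Printing Implicit Defensive.

Local Open Scope group_scope.

(** Iterated rewriting with these rules unfolds conjugates and numeral powers and brings a word to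
    reduced, left-associated form, which settles identities valid in every free group. *)
Definition group_word {gT : groupType} :=
  (@conjgE gT, @expgS gT, @expg1 gT, @invgM gT, @invgK gT, @mulgA gT,
   @mulgK gT, @mulgVK gT, @mulVg gT, @mulgV gT, @mul1g gT, @mulg1 gT,
   @invg1 gT).

(** * Subgroups of index 2 *)

Section Index2.

Variables (gT : finGroupType) (G H : {group gT}).

(** The hypotheses make [G] the disjoint union of [H] and [x *: H]. *)
Lemma index2_crit x : H \subset G -> x \in G :\: H ->
  {in G :\: H, forall y, x^-1 * y \in H} -> #|G : H| = 2.
Proof.
move=> sHG Gx xH; have /setDP[xG xnH] := Gx.
have defG : G :=: H :|: x *: H.
  apply/setP=> y; rewrite inE mem_lcoset; apply/idP/idP => [yG|].
    by case: (boolP (y \in H)) => //= ynH; apply: xH; rewrite inE ynH.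
  case/orP=> [/(subsetP sHG)//|xyH].
  by rewrite -(mulKVg x y) groupM ?(subsetP sHG (x^-1 * y)).
have dis : H :&: x *: H = set0.
  apply/setP=> y; rewrite !inE mem_lcoset; apply/negP=> /andP[yH].
  by rewrite groupMr // groupV (negPf xnH).
have := Lagrange sHG; rewrite {2}defG cardsU dis cards0 subn0 card_lcoset.
by rewrite addnn -muln2 => /eqP; rewrite eqn_pmul2l ?cardG_gt0 // => /eqP.
Qed.

Hypotheses (sHG : H \subset G) (indexH : #|G : H| = 2).

Lemma index2_memM x y : x \in G -> y \in G ->
  (x * y \in H) = ((x \in H) == (y \in H)).
Proof.
move=> xG yG; case: (boolP (x \in H)) => xH; first by rewrite groupMl.
case: (boolP (y \in H)) => yH; first by rewrite groupMr // (negPf xH).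
(* The coset [H :* y^-1] is the whole complement of [H] in [G], so it contains [x]. *)
have := rcoset_index2 sHG indexH (_ : y^-1 \in G :\: H).
rewrite !inE !groupV yH yG => /(_ isT) /setP/(_ x).
by rewrite mem_rcoset invgK inE xH xG eqxx.
Qed.

Lemma index2_memJ x y : x \in G -> y \in G -> (x ^ y \in H) = (x \in H).
Proof.
by move=> xG yG; rewrite conjgE !index2_memM ?groupM ?groupV //;
  do 2!case: (_ \in H).
Qed.

Lemma index2_memX2 x : x \in G -> x ^+ 2 \in H.
Proof. by move=> xG; rewrite expgS expg1 index2_memM. Qed.

Lemma index2_proper : exists x, x \in G :\: H.
Proof.
apply/set0Pn; apply/negP; rewrite setD_eq0 -indexg_eq1 indexH.
by [].
Qed.

End Index2.

(** The centraliser of [m] in [M] lies strictly between ['Z(M)] and [M], so ['Z(M)] has index 2 in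
    it; both [m] and [n] belong to it and lie outside ['Z(M)]. *)
Lemma center4_commute (gT : finGroupType) (M : {group gT}) m n :
    #|M : 'Z(M)| = 4 -> m \in M :\: 'Z(M) -> n \in M :\: 'Z(M) ->
  commute m n -> m * n \in 'Z(M).
Proof.
move=> indexZ /setDP[mM mZ] /setDP[nM nZ] cmn.
have sZC : 'Z(M) \subset 'C_M[m].
  by rewrite subsetI center_sub sub_cent1 (subsetP _ m mM) // centsC subsetIr.
have mC : m \in 'C_M[m] by rewrite inE mM cent1id.
have nC : n \in 'C_M[m] by rewrite inE nM; apply/cent1P/commute_sym.
have := Lagrange_index (subsetIl M 'C[m]) sZC; rewrite indexZ.
have C1 : #|M : 'C_M[m]| != 1%N.
  rewrite indexg_eq1 subsetI subxx sub_cent1 /=.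
  by apply: contra mZ => mC'; apply/setIP.
have C2 : #|'C_M[m] : 'Z(M)| != 1%N.
  by rewrite indexg_eq1; apply: contra mZ => /subsetP->.
move=> index4; have indexC : #|'C_M[m] : 'Z(M)| = 2.
  have : #|'C_M[m] : 'Z(M)| \in divisors 4.
    by rewrite -dvdn_divisors // -index4 dvdn_mull.
  rewrite !inE (negPf C2) /= => /orP[/eqP//|/eqP C4].
  by move: index4 C1; rewrite C4; case: #|_ : _| => [|[|]].
by rewrite (index2_memM sZC indexC) // (negPf mZ) (negPf nZ).
Qed.

Lemma Aut_of_fun (gT : finGroupType) (R : {group gT}) (f : gT -> gT) :
    {in R &, {morph f : x y / x * y}} -> {in R, forall x, f x \in R} ->
    {in R, forall x, f x = 1 -> x = 1} ->
  exists2 phi : {perm gT}, phi \in Aut R & {in R, phi =1 f}.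
Proof.
move=> fM fR f1; pose F := Morphism fM.
have injF : 'injm F.
  by apply/subsetP=> x; rewrite !inE => /andP[xR /eqP/(f1 x xR)->].
have FR : F @* R = R.
  apply/eqP; rewrite eqEcard card_injm // leqnn andbT.
  by apply/subsetP=> _ /morphimP[x _ xR ->]; apply: fR.
by exists (aut injF FR); [apply: Aut_aut | move=> x xR; rewrite autE].
Qed.

(** * Automorphisms of [R] built from automorphisms of [M] *)

Section Extension.

Variables (gT : finGroupType) (R M : {group gT}).
Hypotheses (sMR : M \subset R) (indexM : #|R : M| = 2).

(** Over [M], the group [R] is determined by the action of [a] on [M] and by the value of [a ^+ 2]
    in [M]. The last two hypotheses say that [u] satisfies the images of these relations under
    [s]. *)
Lemma index2_Aut_extend (s : gT -> gT) a u :
    {in M &, {morph s : x y / x * y}} -> {in M, forall m, s m \in M} ->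
    {in M, forall m, s m = 1 -> m = 1} -> a \in R :\: M -> u \in R :\: M ->
    {in M, forall m, s (m ^ a) = s m ^ u} -> s (a ^+ 2) = u ^+ 2 ->
  exists2 phi : {perm gT}, phi \in Aut R &
    {in M, forall m, phi m = s m /\ phi (a * m) = u * s m}.
Proof.
move=> sM sMM s1 /setDP[aR anM] /setDP[uR unM] sJ s2.
pose f x := if x \in M then s x else u * s (a^-1 * x).
have fm m : m \in M -> f m = s m by rewrite /f => ->.
have fam m : m \in M -> f (a * m) = u * s m.
  by move=> mM; rewrite /f groupMr // (negPf anM) mulKg.
clearbody f; have a2M := index2_memX2 sMR indexM aR.
have MR := subsetP sMR.
have JM m : m \in M -> m ^ a \in M.
  by move=> mM; rewrite (index2_memJ sMR indexM) ?(MR m).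
have caseR x : x \in R -> x \in M \/ exists2 m, m \in M & x = a * m.
  move=> xR; case: (boolP (x \in M)) => xM; [by left | right].
  exists (a^-1 * x); last by rewrite mulKVg.
  by rewrite (index2_memM sMR indexM) ?groupV ?(negPf anM) ?(negPf xM).
have [||x xR|phi phiA phiE] := @Aut_of_fun gT R f.
- move=> x y /caseR[xM|[m mM ->]] /caseR[yM|[n nM ->]].
  + by rewrite !fm ?groupM ?sM.
  + have -> : x * (a * n) = a * (x ^ a * n) by rewrite !group_word.
    have Jxn : x ^ a * n \in M by rewrite groupM ?JM.
    by rewrite !fam // fm // sM ?JM // sJ // !group_word.
  + by rewrite -mulgA !fam ?groupM // fm // sM // mulgA.
  + have -> : a * m * (a * n) = a ^+ 2 * (m ^ a * n) by rewrite !group_word.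
    have Jmn : m ^ a * n \in M by rewrite groupM ?JM.
    rewrite fm ?(groupM a2M) // !fam // (sM _ _ a2M Jmn) s2 sM ?JM // sJ //.
    by rewrite !group_word.
- move=> x /caseR[xM|[m mM ->]]; first by rewrite fm ?MR ?sMM.
  by rewrite fam // groupM ?(MR _ (sMM _ mM)).
- case: (caseR x xR) => [xM|[m mM ->]]; first by rewrite fm //; apply: s1.
  rewrite fam // => /eqP; rewrite -eq_invg_mul => /eqP us; case/negP: unM.
  by rewrite -groupV us sMM.
- exists phi => // m mM; have mR := MR m mM.
  by rewrite !phiE ?groupM // fm ?fam.
Qed.

Definition half_inverting_Aut (phi : {perm gT}) :=
  [/\ phi \in Aut R, phi <> 1
    & forall g, g \in R :\: M -> phi g = g \/ phi g = g^-1].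

(** The element [m0] witnesses nontriviality: the extension moves [a * m0]. *)
Lemma half_inverting_extend (s : gT -> gT) a u m0 :
    {in M &, {morph s : x y / x * y}} -> {in M, forall m, s m \in M} ->
    {in M, forall m, s m = 1 -> m = 1} -> a \in R :\: M -> u \in R :\: M ->
    {in M, forall m, s (m ^ a) = s m ^ u} -> s (a ^+ 2) = u ^+ 2 ->
    {in M, forall m, u * s m = a * m \/ u * s m = (a * m)^-1} ->
    m0 \in M -> u * s m0 <> a * m0 ->
  exists phi, half_inverting_Aut phi.
Proof.
move=> sM sMM s1 aRM uRM sJ s2 us m0M m0E; have /setDP[aR anM] := aRM.
have [phi phiA phiE] := index2_Aut_extend sM sMM s1 aRM uRM sJ s2.
exists phi; split=> // [phi1 | g /setDP[gR gnM]].
  by apply: m0E; have [_ <-] := phiE _ m0M; rewrite phi1 perm1.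
have mM : a^-1 * g \in M.
  by rewrite (index2_memM sMR indexM) ?groupV ?(negPf anM) ?(negPf gnM).
by have [_] := phiE _ mM; have := us _ mM; rewrite mulKVg => + ->.
Qed.

(** * Existence of the automorphism in each of the three cases *)

(** For abelian [M], inverting every element outside [M] extends to an automorphism. It is
    nontrivial unless all these elements are involutions, and then any of them inverts [M]. *)
Lemma half_inverting_abelian :
  abelian M -> ~ generalised_dihedral_on R M ->
  exists phi, half_inverting_Aut phi.
Proof.
move=> abM nGD; have MR := subsetP sMR.
have cM x y : x \in M -> y \in M -> x * y = y * x.
  by move=> xM yM; apply: (centsP abM).
have [a aRM a2] : exists2 a, a \in R :\: M & a ^+ 2 != 1.
  apply/exists_inP; apply: contraT; rewrite negb_exists_in => /forall_inP sq1.
  case: nGD; have [i iRM] := index2_proper indexM.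
  have /setDP[iR inM] := iRM; have i2 := eqP (negPn (sq1 i iRM)).
  split=> //; exists i => //; split.
    by apply: nt_prime_order => //; apply: contraNneq inM => ->.
  move=> m mM; have /sq1 : i * m \in R :\: M.
    by rewrite inE groupMr // inM groupM ?(MR m).
  rewrite negbK => /eqP im; apply/eqP; rewrite eq_mulgV1 invgK.
  have -> : m ^ i * m = i ^- 2 * (i * m) ^+ 2 by rewrite !group_word.
  by rewrite i2 im mulg1 invg1.
have /setDP[aR anM] := aRM.
have JM m : m \in M -> m ^ a^-1 \in M.
  by move=> mM; rewrite (index2_memJ sMR indexM) ?groupV ?(MR m).
(* The map on [M] is forced by sending [a] to [a^-1] and [a * m] to [(a * m)^-1]. *)
apply: (@half_inverting_extend (fun m => m^-1 ^ a^-1) a a^-1 1) => //.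
- by move=> x y xM yM; rewrite cM // invMg conjMg.
- by move=> m mM; rewrite JM ?groupV.
- by move=> m mM /eqP; rewrite conjg_eq1 invg_eq1 => /eqP.
- by rewrite inE !groupV anM.
- move=> m mM; have a2M := index2_memX2 sMR indexM aR.
  rewrite -conjVg conjgK -conjgM -invMg -[a * a]/(a ^+ 2) conjgE.
  by rewrite (cM m^-1) ?groupV // mulKg.
- by rewrite !group_word.
- by move=> m mM; right; rewrite !group_word.
- move/eqP; rewrite invg1 conj1g !mulg1 => /eqP a1.
  by case/negP: a2; rewrite expgS expg1 -{1}a1 mulVg.
Qed.

(** With [c = a ^+ 2], the automorphism sends [a] to [a^-1], fixes [Z] and multiplies the rest of
    [M] by [c]. Then [a * m] is inverted for [m] in [Z], because [a] inverts [m], and fixed for the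
    other [m], because [a^-1 * c = a]. *)
Lemma half_inverting_index2 (Z : {group gT}) a :
    Z \subset M -> #|M : Z| = 2 -> a \in R :\: M -> a ^+ 2 <> 1 ->
    a ^+ 2 \in Z :&: 'Z(R) -> {in Z, forall z, z ^ a = z^-1} ->
  exists phi, half_inverting_Aut phi.
Proof.
move=> sZM indexZ aRM; move Dc: (a ^+ 2) => c c1.
move=> /setIP[cZ /centerP[cR Cc]] invZ.
have cC x : x \in R -> c * x = x * c by move/Cc.
have /setDP[aR anM] := aRM; have MR := subsetP sMR; have ZM := subsetP sZM.
have cJ x : x \in R -> x ^ c = x by move=> xR; apply/conjg_fixP/commgP/esym/cC.
(* As an element of [Z], [c] is inverted by [a]; as a power of [a], it is fixed. *)
have cV : c^-1 = c by rewrite -invZ // -Dc conjXg conjgE mulKg.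
have c2 : c * c = 1 by rewrite -{1}cV mulVg.
have ac m : m \in M -> a^-1 * (c * m) = a * m by rewrite -Dc !group_word.
have Ja m : m \in M -> m ^ a \in M.
  by move=> mM; rewrite (index2_memJ sMR indexM) ?(MR m).
have JaZ m : m \in M -> (m ^ a \in Z) = (m \in Z).
  move=> mM; apply/idP/idP => mZ; last by rewrite invZ ?groupV.
  by rewrite -(cJ m (MR m mM)) -Dc expgS expg1 conjgM invZ ?groupV.
pose s m := if m \in Z then m else c * m.
have sZ m : m \in Z -> s m = m by rewrite /s => ->.
have snZ m : m \notin Z -> s m = c * m by rewrite /s => /negPf->.
apply: (@half_inverting_extend s a a^-1 1) => //.
- move=> x y xM yM; have xR := MR x xM; rewrite /s (index2_memM sZM indexZ) //.
  case: (x \in Z); case: (y \in Z) => //=.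
  + by rewrite !mulgA cC.
  + by rewrite mulgA.
  + by rewrite -mulgA (mulgA x) -(cC x) // !mulgA c2 mul1g.
- by move=> m mM; rewrite /s; case: ifP => // _; rewrite groupM ?(ZM c).
- move=> m mM; rewrite /s; case: (boolP (m \in Z)) => // mnZ /eqP.
  by rewrite -eq_invg_mul => /eqP cm; case/negP: mnZ; rewrite -cm groupV.
- by rewrite inE !groupV anM.
- move=> m mM; have mR := MR m mM.
  have mJ : m ^ a = m ^ a^-1.
    by rewrite -[m in RHS]cJ // -conjgM -Dc expgS expg1 mulgK.
  rewrite /s JaZ // mJ; case: ifP => // _.
  have ca : c ^ a^-1 = c by rewrite -Dc conjXg conjgE mulgV mulg1 invgK.
  by rewrite conjMg ca.
- by rewrite Dc sZ // -[c]cV -Dc -expgVn.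
- move=> m mM; rewrite /s; case: ifPn => mZ; last by left; apply: ac.
  by right; rewrite invMg -(invZ m mZ) !group_word.
- move/eqP; rewrite sZ // !mulg1 => /eqP a1.
  by case: c1; rewrite -Dc expgS expg1 -{1}a1 mulVg.
Qed.

(* The automorphism fixes [a] and sends [m] to [a^-1 * m^-1 * a^-1] for [m] in
   [M] outside its centre; the factor [c = a ^+ 2] repairs the order reversal,
   since noncommuting elements of [M] have commutator [c]. *)
Lemma half_inverting_center4 a m0 :
    #|M : 'Z(M)| = 4 -> a \in R :\: M -> M^`(1) = <[a ^+ 2]> -> #[a] = 4 ->
    {in 'Z(M), forall z, z ^ a = z^-1} -> m0 \in M :\: 'Z(M) ->
    #[a * m0] <> 2 ->
  exists phi, half_inverting_Aut phi.
Proof.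
move=> indexZ aRM; move Dc: (a ^+ 2) => c M'c oa invZ /setDP[m0M m0Z] oam0.
have /setDP[aR anM] := aRM; have MR := subsetP sMR.
have ZM z : z \in 'Z(M) -> z \in M by apply: (subsetP (center_sub M)).
have oc : #[c] = 2 by rewrite -Dc orderXdiv oa.
have M'E x y : x \in M -> y \in M -> [~ x, y] = 1 \/ [~ x, y] = c.
  move=> xM yM; have : [~ x, y] \in M^`(1) by rewrite mem_commg.
  by rewrite M'c cycle2g // !inE => /orP[] /eqP; [left | right].
have cM : c \in M by rewrite -Dc (index2_memX2 sMR indexM).
have c2 : c * c = 1 by rewrite -[c * c]/(c ^+ 2) -oc expg_order.
have cV : c^-1 = c by apply/eqP; rewrite eq_invg_mul c2.
have c1 : c != 1 by rewrite -order_gt1 oc.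
(* Otherwise [[~ c, x] = c], so that [c ^ x = c * c = 1]. *)
have cC x : x \in M -> c * x = x * c.
  move=> xM; apply/commgP; apply: contraR c1 => cx.
  have [/eqP|] := M'E c x cM xM; first by rewrite (negPf cx).
  move=> e; have /eqP : c ^ x = 1 by rewrite -(mulKVg c (c ^ x)) -commgEl e.
  by rewrite conjg_eq1.
have cZ : c \in 'Z(M).
  by apply/centerP; split=> // x xM; apply: cC.
have cZC z x : z \in 'Z(M) -> x \in M -> z * x = x * z.
  by case/centerP=> _ Cz /Cz.
have Ja m : m \in M -> m ^ a \in M.
  by move=> mM; rewrite (index2_memJ sMR indexM) ?(MR m).
have JaZ m : m \in M -> (m ^ a \in 'Z(M)) = (m \in 'Z(M)).
  move=> mM; apply/idP/idP => mZ; last by rewrite invZ ?groupV.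
  have -> : m = (m ^ a) ^ a.
    by rewrite -conjgM -[a * a]/(a ^+ 2) Dc conjgE -cC // mulKg.
  by rewrite invZ ?groupV.
have Jc : c ^ a = c by rewrite invZ.
pose s m := if m \in 'Z(M) then m else c * m^-1 ^ a.
have sZ m : m \in 'Z(M) -> s m = m by rewrite /s => ->.
have snZ m : m \notin 'Z(M) -> s m = c * m^-1 ^ a by rewrite /s => /negPf->.
have aV : a^-1 = a * c.
  by apply/eqP; rewrite eq_invg_mul mulgA -[a * a]/(a ^+ 2) Dc c2.
have as_nZ m : m \in M -> m \notin 'Z(M) -> a * s m = (a * m)^-1.
  move=> mM mZ; rewrite snZ // cC ?Ja ?groupV // invMg aV conjgE.
  by rewrite -!mulgA mulKVg.
(* Order 1 is excluded first, so that [(a * m0) ^+ 2 = 1] will contradict [oam0]. *)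
have [m0E | am0_neq1] := eqVneq (a * m0) 1.
  case/negP: anM; have -> : a = m0^-1 by rewrite -[a](mulgK m0) m0E mul1g.
  by rewrite groupV.
apply: (@half_inverting_extend s a a m0) => //.
- move=> x y xM yM; rewrite /s.
  have xV : x^-1 ^ a \in M by rewrite Ja ?groupV.
  have yV : y^-1 ^ a \in M by rewrite Ja ?groupV.
  case: (boolP (x \in 'Z(M))) => xZ.
    rewrite groupMl //; case: ifPn => // yZ.
    rewrite [RHS](cZC x) ?(groupM cM yV) // invMg conjMg.
    by rewrite (invZ x^-1) ?groupV // invgK mulgA.
  case: (boolP (y \in 'Z(M))) => yZ.
    rewrite groupMr // (negPf xZ) invMg conjMg (invZ y^-1) ?groupV // invgK.
    by rewrite (cZC y) ?Ja ?groupV // mulgA.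
  (* For [x] and [y] noncentral the two factors [c] cancel. If [x * y] is central, it equals [y * x]
     and [a] inverts it; otherwise [x] and [y] do not commute, and [x * y = y * x * c] supplies the
     factor [c] in [s (x * y)]. *)
  have -> : c * x^-1 ^ a * (c * y^-1 ^ a) = (y * x)^-1 ^ a.
    by rewrite cC // -mulgA (mulgA c) c2 mul1g invMg conjMg.
  case: ifPn => xyZ.
    have <- : x * y = y * x.
      by apply: (mulgI x); rewrite -(cZC _ _ xyZ xM) mulgA.
    by rewrite invZ ?groupV ?invgK.
  have -> : x * y = y * x * c.
    rewrite commgC; congr (_ * _); have [/eqP/commgP cxy|//] := M'E x y xM yM.
    by case/negP: xyZ; apply: center4_commute; rewrite // inE ?xZ ?yZ.
  by rewrite invMg conjMg cV Jc mulgA c2 mul1g.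
- move=> m mM; rewrite /s; case: ifP => // _; rewrite groupM ?Ja ?groupV //.
- move=> m mM; rewrite /s; case: (boolP (m \in 'Z(M))) => // mZ /eqP.
  rewrite -eq_invg_mul cV => /eqP cm; case/negP: mZ.
  by rewrite -groupV -JaZ ?groupV // -cm.
- move=> m mM; rewrite /s JaZ //; case: ifP => // _.
  by rewrite conjMg Jc !conjVg.
- by rewrite Dc sZ.
- move=> m mM; case: (boolP (m \in 'Z(M))) => mZ; first by left; rewrite sZ.
  by right; rewrite as_nZ.
- rewrite as_nZ // => e; apply: oam0; apply: nt_prime_order => //.
  by rewrite expgS expg1 -{1}e mulVg.
Qed.

(** * Consequences of the existence of the automorphism *)

(** The complement of [M] generates [R]: an element [x] of [M] is the quotient of [x * h] by [h],
    both outside [M]. *)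
Lemma half_inverting_moved phi :
  half_inverting_Aut phi -> exists2 g, g \in R :\: M & phi g <> g.
Proof.
case=> phiA phi1 _; have phiM := morphicP (Aut_morphic phiA).
have [h hRM] := index2_proper indexM; have /setDP[hR hnM] := hRM.
have [/exists_inP[g gRM /eqP gE] | ] := boolP [exists g in R :\: M, phi g != g].
  by exists g.
rewrite negb_exists_in => /forall_inP fixRM; case: phi1.
have phiE g : g \in R -> g \notin M -> phi g = g.
  by move=> gR gnM; apply/eqP; rewrite -[_ == _]negbK fixRM ?inE ?gnM.
apply: (eq_Aut phiA (group1 _)) => x xR; rewrite perm1.
case: (boolP (x \in M)) => xM; last exact: phiE.
have xhM : x * h \notin M by rewrite groupMl.
by apply: (mulIg h); rewrite -{1}(phiE h) // -phiM // phiE // groupM.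
Qed.

(** In a generalised dihedral group on [M] every element outside [M] equals its inverse, so [phi]
    would fix all of them. *)
Lemma half_inverting_not_dihedral phi :
  half_inverting_Aut phi -> ~ generalised_dihedral_on R M.
Proof.
move=> hphi [_ abM _ [i /setDP[iR inM] [i2 invM]]].
have [g /setDP[gR gnM] gE] := half_inverting_moved hphi.
case: hphi => _ _ /(_ g); rewrite inE gnM => /(_ gR)[//|gV]; apply: gE.
have mM : i^-1 * g \in M.
  by rewrite (index2_memM sMR indexM) ?groupV // (negPf inM) (negPf gnM).
have iV : i^-1 = i.
  by apply/eqP; rewrite eq_invg_mul -[i * i]/(i ^+ 2) -i2 expg_order.
rewrite iV in mM; rewrite gV; apply: (mulIg i); have := invM _ mM.
by rewrite !group_word iV => ->.
Qed.

(** If [phi] inverted everything outside [M], it would act on [M] as inversion followed by a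
    conjugation; inversion would then be multiplicative on [M]. *)
Lemma half_inverting_fixed phi :
    half_inverting_Aut phi -> ~~ abelian M ->
  exists2 b, b \in R :\: M & phi b = b.
Proof.
move=> hphi nabM; have [phiA phi1 phiE] := hphi.
have phiM := morphicP (Aut_morphic phiA); have MR := subsetP sMR.
have [/exists_inP[b bRM /eqP bE] | ] := boolP [exists b in R :\: M, phi b == b].
  by exists b.
rewrite negb_exists_in => /forall_inP movRM; case/negP: nabM.
have phiV g : g \in R :\: M -> phi g = g^-1.
  by move=> gRM; have [gE|//] := phiE g gRM; case/eqP: (movRM g gRM).
have [a aRM] := index2_proper indexM; have /setDP[aR anM] := aRM.
have phiMM m : m \in M -> phi m = a * m^-1 * a^-1.
  move=> mM; have mR := MR m mM; apply: (mulgI (phi a)); rewrite -phiM //.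
  by rewrite !phiV // ?inE ?groupMr ?anM ?groupM // !group_word.
rewrite /abelian; apply/centsP=> x xM y yM.
have xR := MR x xM; have yR := MR y yM.
have := phiM x y xR yR; rewrite !phiMM ?groupM // => e.
have {}e : (x * y)^-1 = x^-1 * y^-1.
  by apply: (mulgI a); apply: (mulIg a^-1); rewrite e !group_word.
by apply: invg_inj; rewrite e invMg.
Qed.

(** * The fixed points of [phi] in [M] when [phi] fixes some [b] outside [M] *)

Section FixedOutside.

Variables (phi : {perm gT}) (b : gT).
Hypotheses (hphi : half_inverting_Aut phi) (bRM : b \in R :\: M).
Hypothesis phib : phi b = b.

Let MR := subsetP sMR.
Let bR : b \in R. Proof. by case/setDP: bRM. Qed.
Let bnM : b \notin M. Proof. by case/setDP: bRM. Qed.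

Let phiM : {in R &, {morph phi : x y / x * y}}.
Proof. by case: hphi => phiA _ _; apply/morphicP/Aut_morphic. Qed.

Let fixM := [set m in M | phi m == m].

Fact fixM_group_set : group_set fixM.
Proof.
have phi1 : phi 1 = 1.
  by apply: (mulgI (phi 1)); rewrite -phiM ?group1 // !mulg1.
apply/group_setP; split=> [|x y]; first by rewrite inE group1 phi1 eqxx.
rewrite !inE => /andP[xM /eqP xE] /andP[yM /eqP yE].
by rewrite groupM // phiM ?MR // xE yE eqxx.
Qed.

Definition fixM_group := Group fixM_group_set.
Let K := fixM_group.

Let KM k : k \in K -> k \in M. Proof. by rewrite inE => /andP[]. Qed.
Let phiK k : k \in K -> phi k = k. Proof. by rewrite inE => /andP[_ /eqP]. Qed.
Let sKM : K \subset M. Proof. exact/subsetP/KM. Qed.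

(** Fixing [b] but not [m], [phi] moves [b * m] and therefore inverts it. *)
Let phi_nK m : m \in M -> m \notin K -> phi m = b^-1 * m^-1 * b^-1.
Proof.
move=> mM; rewrite inE mM /= => /eqP mE.
have bmRM : b * m \in R :\: M by rewrite inE groupMr // bnM groupM ?(MR mM).
case: hphi => _ _ /(_ _ bmRM); rewrite phiM ?(MR mM) // phib.
by case=> [/mulgI//|e]; apply: (mulgI b); rewrite e !group_word.
Qed.

(* Compare [phi (m * k)] with [phi m * phi k]. *)
Let conjK m k : m \in M -> m \notin K -> k \in K -> k ^ b = m * k^-1 * m^-1.
Proof.
move=> mM mK kK; have kM := KM kK; have mkK : m * k \notin K by rewrite groupMr.
have := phiM (MR mM) (MR kM).
rewrite (phi_nK (groupM mM kM) mkK) (phi_nK mM mK) (phiK kK) => e.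
have {}e : k^-1 * m^-1 = m^-1 * b^-1 * k * b.
  by apply: (mulgI b^-1); apply: (mulIg b^-1); move: e; rewrite !group_word.
by apply: (mulgI m^-1); rewrite !group_word -e.
Qed.

(** An element [b * m] moved by [phi] is inverted, hence differs from its inverse. This inequality
    becomes [a ^+ 2 <> 1] in case (2) and [#[a * m] <> 2] in case (3). *)
Let exists_nK : exists2 m, m \in M :\: K & (b * m) ^+ 2 != 1.
Proof.
have [g gRM gE] := half_inverting_moved hphi; have /setDP[gR gnM] := gRM.
have mM : b^-1 * g \in M.
  by rewrite (index2_memM sMR indexM) ?groupV // (negPf bnM) (negPf gnM).
exists (b^-1 * g); rewrite ?mulKVg.
  rewrite inE mM andbT; apply/negP=> /phiK e; apply: gE.
  by rewrite -{1}(mulKVg b g) phiM ?(MR mM) // phib e mulKVg.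
case: hphi => _ _ /(_ g gRM)[//|gV]; apply/negP=> gg; apply: gE.
by rewrite gV; apply/eqP; rewrite eq_invg_mul.
Qed.

(** Both [m] and [m * x] lie outside [K], so by [conjK] they conjugate [y^-1] to the same
    element. *)
Let abK : {in K &, forall x y, x * y = y * x}.
Proof.
have [m /setDP[mM mK] _] := exists_nK => x y xK yK.
have xM := KM xK.
have mxK : m * x \notin K by rewrite groupMr.
have := conjK mM mK yK; rewrite (conjK (groupM mM xM) mxK yK) => e.
have {}e : x * y^-1 * x^-1 = y^-1.
  by apply: (mulgI m); apply: (mulIg m^-1); move: e; rewrite !group_word.
by apply: (mulgI y^-1); rewrite -{1}e !group_word.
Qed.

Let b2K : b ^+ 2 \in K.
Proof.
rewrite inE (index2_memX2 sMR indexM) //=.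
by rewrite expgS expg1 phiM // phib.
Qed.

(** The witness is [a = b * m]: by [conjK], conjugation by [b] followed by conjugation by [m]
    inverts [K]. The square [a ^+ 2] is central because it commutes with [K], [b] and [m], which
    generate [R]. *)
Lemma fixM_index2 : #|M : K| = 2 ->
  [/\ K \subset M, abelian K, #|M : K| = 2
    & exists a, [/\ a \in R :\: M, a ^+ 2 <> 1, a ^+ 2 \in K :&: 'Z(R)
                 & forall z, z \in K -> z ^ a = z^-1]].
Proof.
move=> indexK; split=> //.
  by rewrite /abelian; apply/centsP=> x xK y yK; apply: abK.
have [m /setDP[mM mK] bm2] := exists_nK.
have JbK k : k \in K -> k ^ b \in K.
  move=> kK; rewrite (conjK mM mK kK).
  rewrite -{1}[m]invgK -mulgA -conjgE.
  by rewrite (index2_memJ sKM indexK) ?groupV ?(KM kK).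
have mbM : m ^ b \in M by rewrite (index2_memJ sMR indexM) ?(MR mM).
(* Conjugating by [b] twice amounts to conjugating by [b ^+ 2], an element of [M], which normalises
   [K]. *)
have mbK : m ^ b \notin K.
  apply: contra mK => /JbK; rewrite -conjgM -[b * b]/(b ^+ 2).
  by rewrite (index2_memJ sKM indexK) // (KM b2K).
move Da: (b * m) bm2 => a a2.
have aR : a \in R by rewrite -Da groupM ?(MR mM).
have anM : a \notin M by rewrite -Da groupMr.
have invK k : k \in K -> k ^ a = k^-1.
  by move=> kK; rewrite -Da conjgM (conjK mM mK kK) !group_word.
have a2K : a ^+ 2 \in K.
  have -> : a ^+ 2 = b ^+ 2 * (m ^ b * m) by rewrite -Da !group_word.
  by rewrite groupM // (index2_memM sKM indexK) // (negPf mbK) (negPf mK).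
exists a; split=> //; [by rewrite inE anM | exact/eqP | ].
rewrite inE a2K; apply/centerP; split; first exact: groupX.
have KC k : k \in K -> k \in 'C[a ^+ 2] by move=> kK; apply/cent1P/abK.
(* Here [a ^ b = a * k] with [k] in [K]; as [a] inverts [k], the square of [a * k] is [a ^+ 2]. *)
have bC : b \in 'C[a ^+ 2].
  have kK : m^-1 * m ^ b \in K.
    by rewrite (index2_memM sKM indexK) ?groupV // (negPf mbK) (negPf mK).
  have ab : a ^ b = a * (m^-1 * m ^ b) by rewrite -Da !group_word.
  apply/cent1P/esym/commgP/conjg_fixP; rewrite conjXg ab.
  have := invK _ kK; move: (m^-1 * m ^ b) => k ka.
  have -> : (a * k) ^+ 2 = a ^+ 2 * (k ^ a * k) by rewrite !group_word.
  by rewrite ka mulVg mulg1.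
have mC : m \in 'C[a ^+ 2].
  have -> : m = b^-1 * a by rewrite -Da mulKg.
  by rewrite groupM ?groupV //; apply/cent1P; rewrite /commute -expgS -expgSr.
have MC x : x \in M -> x \in 'C[a ^+ 2].
  move=> xM; case: (boolP (x \in K)) => [/KC//|xK].
  rewrite -(mulKVg m x) groupM ?(KC (m^-1 * x)) //.
  by rewrite (index2_memM sKM indexK) ?groupV // (negPf xK) (negPf mK).
move=> x xR; apply/esym/cent1P; case: (boolP (x \in M)) => [/MC//|xM].
rewrite -(mulKVg b x) groupM ?(MC (b^-1 * x)) //.
by rewrite (index2_memM sMR indexM) ?groupV // (negPf xM) (negPf bnM).
Qed.

Lemma fixM_center : ~~ abelian M -> #|M : K| <> 2 ->
  #|M : 'Z(M)| = 4 /\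
  [/\ M^`(1) = <[b ^+ 2]>, #[b] = 4, forall z, z \in 'Z(M) -> z ^ b = z^-1
    & exists2 m, m \in M :\: 'Z(M) & #[b * m] <> 2].
Proof.
move=> nabM indexK; move Dc: (b ^+ 2) (b2K) => c cK.
have cM := KM cK.
(* If no such [n] existed, [m^-1] would represent the only nontrivial coset of [K], and [K] would
   have index 2. *)
have ex_n m : m \in M -> m \notin K ->
    exists n, [/\ n \in M, n \notin K & m * n \notin K].
  move=> mM mK.
  have [/existsP[n /and3P[nM nK mnK]] | ] :=
    boolP [exists n, [&& n \in M, n \notin K & m * n \notin K]].
    by exists n.
  rewrite negb_exists => /forallP allK; case: indexK.
  apply: (@index2_crit gT M K m^-1 sKM); first by rewrite inE !groupV mK.
  move=> n /setDP[nM nK]; rewrite invgK.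
  by have := allK n; rewrite nM nK /= negbK.
have [m0 /setDP[m0M m0K] bm0] := exists_nK.
(* By [conjK], [m0] and [n] act alike on [K], so [m0^-1 * n] centralises [K]; being outside [K]
   itself, it also computes [k ^ b]. *)
have invK k : k \in K -> k ^ b = k^-1.
  move=> kK; have m0'K : m0^-1 \notin K by rewrite groupV.
  have [n [nM nK mnK]] := ex_n _ (groupVr m0M) m0'K.
  have e := conjK m0M m0K kK; rewrite {1}(conjK nM nK kK) in e.
  rewrite (conjK (groupM (groupVr m0M) nM) mnK kK).
  by apply: (mulgI m0); apply: (mulIg m0^-1); move: e; rewrite !group_word.
have KC m k : m \in M -> k \in K -> k * m = m * k.
  move=> mM kK; have [mK|mK] := boolP (m \in K); first exact: abK.
  have := conjK mM mK (groupVr kK); rewrite invK ?groupV // !invgK => e.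
  by rewrite {1}e !group_word.
have cV : c^-1 = c by rewrite -invK // -Dc conjXg conjgE mulKg.
have c2 : c * c = 1 by rewrite -{1}cV mulVg.
(* Multiplicativity of [phi] gives [(m * n)^-1 = m^-1 * c^-1 * n^-1], where [c] is central in
   [M]. *)
have comE m n : m \in M -> n \in M -> m \notin K -> n \notin K ->
    m * n \notin K -> m * n = n * m * c.
  move=> mM nM mK nK mnK; have := phiM (MR mM) (MR nM).
  rewrite (phi_nK (groupM mM nM) mnK) (phi_nK mM mK) (phi_nK nM nK) => e.
  apply: invg_inj; apply: (mulgI b^-1); apply: (mulIg b^-1); rewrite e.
  rewrite (invMg _ c) invMg (mulgA c^-1) (KC m^-1 c^-1) ?groupV // -Dc.
  by rewrite !group_word.
have c1 : c != 1.
  apply: contraNneq nabM => c1; rewrite /abelian; apply/centsP=> x xM y yM.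
  have [xK|xK] := boolP (x \in K); first exact: KC.
  have [yK|yK] := boolP (y \in K); first exact/esym/KC.
  have [xyK|xyK] := boolP (x * y \in K).
    by apply: (mulgI x); rewrite -(KC _ _ xM xyK) mulgA.
  by rewrite /commute comE // c1 mulg1.
have oc : #[c] = 2 by apply: nt_prime_order; rewrite // expgS expg1.
have ob : #[b] = 4.
  have : #[b] \in divisors 4.
    by rewrite -dvdn_divisors // order_dvdn (expgM b 2 2) Dc expgS expg1 c2.
  by rewrite !inE => /or3P[] /eqP ob //;
    case/negP: c1; rewrite -Dc -order_dvdn ob.
have [n0 [n0M n0K mnK]] := ex_n m0 m0M m0K.
have mn0 : m0 * n0 = n0 * m0 * c by apply: comE.
have ncomm m n : m \in M -> n \in M -> m \notin K -> n \notin K ->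
    m * n \notin K -> ~ commute m n.
  move=> mM nM mK nK mnK' cmn; case/eqP: c1.
  by apply: (mulgI (n * m)); rewrite -comE // mulg1.
have ZE : 'Z(M) = K :> {set gT}.
  apply/setP=> x; apply/idP/idP => [/centerP[xM xC]|xK].
    apply: contraT => xK; have [n [nM nK xnK]] := ex_n x xM xK.
    by case: (ncomm x n xM nM xK nK xnK); apply: xC.
  by apply/centerP; split=> [|y yM]; [apply: KM | apply: KC].
(* The index splits as 2 times 2 at the centraliser of [m0]. If [y] in it lies outside [K], then
   [m0^-1 * y] is in [K] by [ncomm]. If [y] in [M] lies outside the centraliser, [m0] has the same
   commutator [c] with [y] and with [n0], so [n0^-1 * y] commutes with [m0]. *)
have index4 : #|M : K| = 4.
  have sKC : K \subset 'C_M[m0].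
    by apply/subsetP=> k kK; rewrite inE KM //=; apply/cent1P/KC.
  rewrite -(Lagrange_index (subsetIl M 'C[m0]) sKC).
  have -> : #|'C_M[m0] : K| = 2.
    apply: (@index2_crit gT _ K m0 sKC).
      by apply/setDP; split; first by apply/setIP; rewrite cent1id.
    move=> y /setDP[/setIP[yM /cent1P cy] yK]; apply: contraT => myK.
    case: (ncomm m0^-1 y); rewrite ?groupV //.
    by apply/commute_sym/commuteV.
  rewrite (@index2_crit gT _ _ n0 (subsetIl M 'C[m0])) //.
    apply/setDP; split=> //; apply/setIP=> -[_ /cent1P cm].
    by case: (ncomm m0 n0); rewrite // /commute -cm.
  move=> y /setDP[yM]; rewrite 2!in_setI yM groupM ?groupV //= => ym.
  have yK : y \notin K by apply: contra ym => yK; apply/cent1P/KC.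
  have myK : m0 * y \notin K.
    apply: contra ym => myK; apply/cent1P; apply: (mulgI m0).
    by rewrite mulgA; apply: KC.
  have my : m0 * y = y * m0 * c by apply: comE.
  have nm : n0 * m0 = m0 * n0 * c by rewrite mn0 -mulgA c2 mulg1.
  apply/cent1P; apply: (mulgI n0); rewrite !mulgA mulgV mul1g nm.
  rewrite -(mulgA _ c) (KC n0^-1 c) ?groupV // mulgA mulgK.
  by rewrite -(mulgA m0) (KC y) // mulgA my -mulgA c2 mulg1.
rewrite ZE; split=> //; split.
- apply/eqP; rewrite eqEsubset cycle_subG; apply/andP; split.
    rewrite gen_subG; apply/subsetP=> _ /imset2P[x y xM yM ->].
    rewrite /= cycle2g // !inE.
    have [xK|xK] := boolP (x \in K).
      by rewrite (introT commgP) //; apply: KC.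
    have [yK|yK] := boolP (y \in K).
      by rewrite (introT commgP) //; apply/esym/KC.
    (* A central product [x * y] commutes with [x], so [x] and [y] commute. *)
    have [xyK|xyK] := boolP (x * y \in K).
      rewrite (introT commgP) //; apply: (mulgI x); rewrite -(KC _ _ xM xyK).
      by rewrite mulgA.
    apply/orP; right; apply/eqP; apply: (mulgI (y * x)).
    by rewrite -commgC; apply: comE.
  have -> : c = [~ m0, n0] by apply: (mulgI (n0 * m0)); rewrite -commgC.
  exact: mem_commg.
- by [].
- by move=> z; apply: invK.
- exists m0; first by rewrite inE m0K.
  by move=> o; case/negP: bm0; rewrite -o expg_order.
Qed.

End FixedOutside.
End Extension.

Unset Implicit Arguments.

Theorem theorem1p1 (gT : finGroupType) (R M : {group gT})
    (sMR : M \subset R) (indexM : #|R : M| = 2) :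
  (exists phi : {perm gT},
     [/\ phi \in Aut R, phi <> 1
       & forall g, g \in R :\: M -> phi g = g \/ phi g = g^-1])
  <->
  [\/ abelian M /\ ~ generalised_dihedral_on R M,
      exists Z : {group gT},
        [/\ Z \subset M, abelian Z, #|M : Z| = 2
          & exists a, [/\ a \in R :\: M, a ^+ 2 <> 1,
                          a ^+ 2 \in Z :&: 'Z(R)
                        & forall z, z \in Z -> z ^ a = z^-1]]
    | #|M : 'Z(M)| = 4 /\
      exists a, [/\ a \in R :\: M, M^`(1) = <[a ^+ 2]>, #[a] = 4,
                    forall z, z \in 'Z(M) -> z ^ a = z^-1
                  & exists2 m, m \in M :\: 'Z(M) & #[a * m] <> 2]].
Proof.
split=> [[phi hphi] | [[abM nGD] | [Z [sZM abZ indexZ [a [aRM a2 a2Z invZ]]]]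
                                | [indexZ [a [aRM M'E oa invZ [m mMZ oam]]]]]].
- have [abM|nabM] := boolP (abelian M).
    by apply: Or31; split=> //; apply: (half_inverting_not_dihedral _ _ hphi).
  have [b bRM phib] := half_inverting_fixed sMR indexM hphi nabM.
  have [indexK|/eqP indexK] := eqVneq #|M : fixM_group sMR hphi| 2.
    apply: Or32; exists (fixM_group sMR hphi).
    exact: fixM_index2 bRM phib indexK.
  have [indexZ [M'E ob invZ mE]] :=
    fixM_center indexM bRM phib nabM indexK.
  by apply: Or33; split=> //; exists b.
- exact: half_inverting_abelian.
- exact: half_inverting_index2 indexZ aRM a2 a2Z invZ.
- exact: half_inverting_center4 indexZ aRM M'E oa invZ mMZ oam.
Qed.
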